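(* The covariant measurement on $\mathbb{C}^d$ maps states into probability distributions in an (almost) isometric way: its measurement map $\mathcal M$ satisfies, for states $\rho,\tau$, $$\|\mathcal M(\rho)-\mathcal M(\tau)\|^2=\frac{d}{d+1}\,\|\rho-\tau\|_2^2 ;$$ indeed $\|\mathcal M(X)\|^2=\frac{d}{d+1}\|X\|_2^2$ for any traceless $X$. As a corollary, for the covariant measurement the positive least squares estimator is the projection of the least squares estimator onto the set of density matrices with respect to the Frobenius distance; that is, for this measurement the positive least squares estimator coincides with the projected least squares estimator, $\hat\rho_{\rm posLS}=\hat\rho_{\rm PLS}$.
   Context: $\mathcal S_d$ is the set of $d\times d$ density matrices and $\|X\|_2^2=\mathrm{Tr}(X^*X)$ is the squared Frobenius norm. The covariant measurement has outcomes $P$ in the space of one-dimensional orthogonal projections on $\mathbb{C}^d$ and positive operator valued measure $d\cdot P\cdot\mathrm{d}P$, where $\mathrm{d}P$ is the unitarily invariant probability measure. Its measurement map sends $X$ to the function $\mathcal M(X)(P)=d\,\mathrm{Tr}(PX)$, with $\|\mathcal M(X)\|^2=d^2\int |\mathrm{Tr}(PX)|^2\,\mathrm{d}P$. For a measurement with measurement map $\mathcal M$ and observed vector of empirical outcome frequencies $\boldsymbol f$, the least squares estimator $\hat\rho_{\rm LS}$ minimises $\|\mathcal M(\tau)-\boldsymbol f\|^2$ over selfadjoint matrices $\tau$ without positivity constraint, and the positive least squares estimator is the same minimisation restricted to density matrices, $\hat\rho_{\rm posLS}=\arg\min_{\tau\in\mathcal S_d}\|\mathcal M(\tau)-\boldsymbol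 f\|^2$; consequently $\hat\rho_{\rm posLS}$ is the projection of $\hat\rho_{\rm LS}$ onto $\mathcal S_d$ with respect to the distance $d_{\mathcal M}(\rho,\tau)=\|\mathcal M(\rho)-\mathcal M(\tau)\|$. For the covariant measurement with independent outcomes $P_1,\dots,P_N$, $\hat\rho_{\rm LS}=\frac{d+1}{N}\sum_{i=1}^N\big(P_i-\frac{\mathbf 1}{d+1}\big)$. The projected least squares estimator is $\hat\rho_{\rm PLS}=\arg\min_{\tau\in\mathcal S_d}\|\hat\rho_{\rm LS}-\tau\|_2$. *)

(* Defs.v *)
From HB Require Import structures.
From mathcomp Require Import all_boot all_order all_algebra.
From mathcomp Require Import sesquilinear spectral.
From mathcomp Require Import complex.
From mathcomp Require Import all_classical all_reals all_analysis.
Set Implicit Arguments.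
Unset Strict Implicit.
Unset Printing Implicit Defensive.
Import Order.TTheory GRing.Theory Num.Theory.
Import numFieldNormedType.Exports.
Local Open Scope classical_set_scope.
Local Open Scope ring_scope.
Local Open Scope sesquilinear_scope.

Definition is_rank1proj (R : realType) (d : nat) (P : 'M[R[i]]_d) : bool :=
  [&& P \is hermsymmx, P *m P == P & \rank P == 1%N].

Definition rank1proj (R : realType) (d : nat) : Type :=
  {P : 'M[R[i]]_d | is_rank1proj P}.

HB.instance Definition _ (R : realType) (d : nat) := Choice.on (rank1proj R d).

Fact delta_rank1proj (R : realType) (n : nat) :
  is_rank1proj (delta_mx 0 0 : 'M[R[i]]_n.+1).
Proof.
apply/and3P; split.
- by rewrite qualifE /= expr0 scale1r trmx_delta map_delta_mx.
- by rewrite mul_delta_mx.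
- by rewrite mxrank_delta.
Qed.

(* The library requires measurable spaces to be pointed, hence the dimension
   n.+1: the space of rank-one projections is empty in dimension 0. *)
HB.instance Definition _ (R : realType) (n : nat) :=
  isPointed.Build (rank1proj R n.+1)
    (exist (@is_rank1proj R n.+1) _ (delta_rank1proj R n)).

(* The smallest sigma-algebra making the real and imaginary parts of all matrix
   entries measurable; it is the Borel sigma-algebra of the subspace topology
   inherited from the complex matrices. *)
Definition entry_cylinders (R : realType) (d : nat) : set (set (rank1proj R d)) :=
  [set A | exists (i j : 'I_d) (B : set R), measurable B /\
     (A = [set P : rank1proj R d | B (complex.Re (sval P i j))] \/
      A = [set P : rank1proj R d | B (complex.Im (sval P i j))])].

HB.instance Definition _ (R : realType) (n : nat) :=
  @isMeasurable.Build (sigma_display (@entry_cylinders R n.+1))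
    (rank1proj R n.+1) <<s @entry_cylinders R n.+1 >>
    (@sigma_algebra0 _ setT _) (@sigma_algebraC _ _)
    (@sigma_algebra_bigcup _ setT _).

Fact unitary_conj_subproof (R : realType) (d : nat) (U : 'M[R[i]]_d)
    (hU : U \is unitarymx) (P : rank1proj R d) :
  is_rank1proj (U *m sval P *m U ^t*).
Proof.
case: P => P /= /and3P[Ph /eqP PP /eqP Pr].
have UU : U ^t* *m U = 1%:M by apply: mulmx1C; exact/unitarymxP.
apply/and3P; split.
- rewrite qualifE /= expr0 scale1r !(trmx_mul, map_mxM) /= trmxCK mulmxA.
  by move: Ph; rewrite qualifE /= expr0 scale1r => /eqP <-.
- by rewrite -!mulmxA (mulmxA (U ^t*)) UU mul1mx (mulmxA P) PP.
- have Uu : U \in unitmx by have [] := mulmx1_unit UU.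
  have U'u : U ^t* \in unitmx by have [] := mulmx1_unit UU.
  by rewrite mxrankMfree ?row_free_unit // eqmxMfull ?row_full_unit // Pr.
Qed.

Definition unitary_conj (R : realType) (d : nat) (U : 'M[R[i]]_d)
    (hU : U \is unitarymx) (P : rank1proj R d) : rank1proj R d :=
  exist (@is_rank1proj R d) (U *m sval P *m U ^t*) (unitary_conj_subproof hU P).

Definition unitarily_invariant (R : realType) (n : nat)
    (mu : set (rank1proj R n.+1) -> \bar R) : Prop :=
  forall (U : 'M[R[i]]_n.+1) (hU : U \is unitarymx)
    (A : set (rank1proj R n.+1)),
  measurable A -> mu (unitary_conj hU @^-1` A) = mu A.

Definition density_matrix (R : realType) (d : nat) : set 'M[R[i]]_d :=
  [set rho | [/\ rho \is hermsymmx,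
     forall v : 'cV[R[i]]_d, 0 <= (v ^t* *m rho *m v) 0 0 & \tr rho = 1]].

Definition frobenius2 (R : realType) (d : nat) (X : 'M[R[i]]_d) : R :=
  complex.Re (\tr (X ^t* *m X)).

Definition frobenius (R : realType) (d : nat) (X : 'M[R[i]]_d) : R :=
  Num.sqrt (frobenius2 X).

Definition meas_map (R : realType) (d : nat) (X : 'M[R[i]]_d)
    (P : rank1proj R d) : R[i] :=
  d%:R * \tr (sval P *m X).

(* Squared norm of L^2(mu), extended-real valued. *)
Definition L2norm2 (R : realType) (n : nat)
    (mu : {measure set (rank1proj R n.+1) -> \bar R})
    (h : rank1proj R n.+1 -> R[i]) : \bar R :=
  (\int[mu]_P ((ComplexField.Normc.normc (h P)) ^+ 2)%:E)%E.

Definition meas_dist (R : realType) (n : nat)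
    (mu : {measure set (rank1proj R n.+1) -> \bar R})
    (rho tau : 'M[R[i]]_n.+1) : \bar R :=
  sqrte (L2norm2 mu (fun P => meas_map rho P - meas_map tau P)).

Definition is_argmin (disp : Order.disp_t) (V : porderType disp) (T : Type)
    (S : set T) (f : T -> V) (x : T) : Prop :=
  S x /\ forall y, S y -> (f x <= f y)%O.

(* The frequencies f are the empirical measure of the outcomes P_i, which has no
   density with respect to mu.  Expanding
     |M tau - f|^2 = |M tau|^2 - 2 <M tau, f> + |f|^2
   with <M tau, f> the integral of M tau against f, the term |f|^2 does not
   depend on tau (and is infinite); the least squares loss is the rest.
   M tau is real-valued when tau is selfadjoint. *)
Definition ls_loss (R : realType) (n : nat)
    (mu : {measure set (rank1proj R n.+1) -> \bar R})
    (N : nat) (P : 'I_N -> rank1proj R n.+1) (tau : 'M[R[i]]_n.+1) : \bar R :=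
  (L2norm2 mu (meas_map tau) -
   (2 * (N%:R^-1 * \sum_(i < N) complex.Re (meas_map tau (P i))))%:E)%E.

Definition is_LS (R : realType) (n : nat)
    (mu : {measure set (rank1proj R n.+1) -> \bar R})
    (N : nat) (P : 'I_N -> rank1proj R n.+1) : 'M[R[i]]_n.+1 -> Prop :=
  is_argmin [set tau | tau \is hermsymmx] (ls_loss mu P).

Definition is_posLS (R : realType) (n : nat)
    (mu : {measure set (rank1proj R n.+1) -> \bar R})
    (N : nat) (P : 'I_N -> rank1proj R n.+1) : 'M[R[i]]_n.+1 -> Prop :=
  is_argmin (@density_matrix R n.+1) (ls_loss mu P).

Definition rho_LS (R : realType) (d : nat) (N : nat)
    (P : 'I_N -> rank1proj R d) : 'M[R[i]]_d :=
  ((d%:R + 1) / N%:R) *: \sum_(i < N) (sval (P i) - (d%:R + 1)^-1%:M).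

Definition is_PLS (R : realType) (d : nat) (N : nat)
    (P : 'I_N -> rank1proj R d) : 'M[R[i]]_d -> Prop :=
  is_argmin (@density_matrix R d) (fun tau => frobenius (rho_LS P - tau)).

(* Main.v *)
Require Import Defs.
From mathcomp Require Import all_boot all_order all_algebra.
From mathcomp Require Import fingroup perm sesquilinear spectral.
From mathcomp Require Import complex.
From mathcomp Require Import all_classical all_reals all_analysis.
From mathcomp Require Import measurable_realfun ring lra.
Set Implicit Arguments.
Unset Strict Implicit.
Unset Printing Implicit Defensive.
Import Order.TTheory GRing.Theory Num.Theory.
Import numFieldNormedType.Exports.
Local Open Scope classical_set_scope.
Local Open Scope ring_scope.
Local Open Scope sesquilinear_scope.

(** For Hermitian A let q(A) be the second moment of Tr(PA).  It is invariant
    under unitary conjugation, so by the spectral theorem q is determined by its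
    values on diagonal matrices; there permutation invariance leaves only the two
    parameters alpha = E[P_aa^2] and beta = E[P_aa P_bb], and
    q(A) = (alpha - beta) |A|^2 + beta (Tr A)^2.  Rank one gives
    |P_ab|^2 = P_aa P_bb, so evaluating q at E_ab + E_ba and i(E_ab - E_ba) yields
    alpha = 2 beta, and q(1) = 1 then forces beta = 1 / (d (d + 1)).  A general
    matrix is split into its Hermitian and anti-Hermitian parts.

    Since the empirical mean of d Tr(P_i tau) equals
    d/(d+1) (Tr(rho_LS tau) + Tr tau), completing the square turns the least
    squares loss into d/(d+1) (|tau - rho_LS|^2 + (Tr tau - 1)^2) up to a
    constant.  On density matrices it is thus an increasing function of the
    Frobenius distance to rho_LS, whose minimiser exists by compactness and is
    unique by the parallelogram law. *)

(** * Selfadjoint, rank-one and unitary matrices *)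

Lemma hermsymmxP (C : numClosedFieldType) n (A : 'M[C]_n) :
  reflect (A ^t* = A) (A \is hermsymmx).
Proof.
by apply: (iffP (is_hermitianmxP _ _ _)); rewrite expr0 scale1r => /esym.
Qed.

Lemma hermsymmx_entry (C : numClosedFieldType) n (A : 'M[C]_n) i j :
  A \is hermsymmx -> A j i = (A i j)^*.
Proof. by move=> /hermsymmxP {1}<-; rewrite !mxE. Qed.

Lemma mxtrace_hermsymmx_real (C : numClosedFieldType) n (A : 'M[C]_n) :
  A \is hermsymmx -> \tr A \is Num.real.
Proof.
move=> Ah; apply: rpred_sum => i _; apply/CrealP.
by rewrite -hermsymmx_entry.
Qed.

Lemma rank1_factor (F : fieldType) n (P : 'M[F]_n) : \rank P = 1%N ->
  exists (c : 'cV[F]_n) (r : 'rV[F]_n), P = c *m r.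
Proof.
move=> rP; move: (col_base P) (row_base P) (mulmx_base P).
by rewrite rP => c r <-; exists c, r.
Qed.

(** All 2 x 2 minors of a rank-one matrix vanish. For a selfadjoint P this will give |P_ab|^2 = P_aa
    P_bb. *)
Lemma rank1_exchange (F : fieldType) n (P : 'M[F]_n) : \rank P = 1%N ->
  forall i j k l, P i j * P k l = P i l * P k j.
Proof.
move=> /rank1_factor[c [r ->]] i j k l.
by rewrite !mxE !big_ord1; ring.
Qed.

(** Writing P = c r with a column c and a row r gives P P = (r c) P, so the scalar r c is 1; by
    cyclicity it is also the trace. *)
Lemma rank1_idem_trace (F : fieldType) n (P : 'M[F]_n) : \rank P = 1%N ->
  P *m P = P -> \tr P = 1.
Proof.
move=> rP; have [c [r Pcr]] := rank1_factor rP.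
rewrite {1 2}Pcr -mulmxA (mulmxA r) [r *m c]mx11_scalar mul_scalar_mx.
rewrite -scalemxAr -Pcr => PP.
have -> : \tr P = (r *m c) 0 0 by rewrite Pcr mxtrace_mulC /mxtrace big_ord1.
have P0 : P != 0 by rewrite -mxrank_eq0 rP.
have /eqP : ((r *m c) 0 0 - 1) *: P = 0 by rewrite scalerBl scale1r PP subrr.
by rewrite scaler_eq0 (negbTE P0) orbF subr_eq0 => /eqP.
Qed.

(** For a selfadjoint idempotent, Tr P = Tr (P P) is the sum of all |P_kl|^2, so no single term
    exceeds 1. *)
Lemma hermsymmx_idem_entry_le1 (C : numClosedFieldType) n (P : 'M[C]_n) :
  P \is hermsymmx -> P *m P = P -> \tr P = 1 -> forall i j, `|P i j| <= 1.
Proof.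
move=> Ph PP tP i j; rewrite -(@expr_le1 _ 2%N)//.
have -> : 1 = \sum_k \sum_l `|P k l| ^+ 2.
  rewrite -tP -[X in \tr X]PP; apply: eq_bigr => k _.
  by rewrite mxE; apply: eq_bigr => l _; rewrite (hermsymmx_entry k l Ph) normCK.
rewrite (bigD1 i)//= (bigD1 j)//= -addrA lerDl addr_ge0//.
  by apply: sumr_ge0 => l _; rewrite exprn_ge0.
by apply: sumr_ge0 => k _; apply: sumr_ge0 => l _; rewrite exprn_ge0.
Qed.

Lemma mulmxtU (C : numClosedFieldType) n (U : 'M[C]_n) :
  U \is unitarymx -> U ^t* *m U = 1%:M.
Proof. by move=> /unitarymxP UU; apply: mulmx1C. Qed.

(** The spectral theorem, with the eigenvalues given as elements of the real field [R]. *)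
Lemma hermsymmx_unitary_diag (R : rcfType) n (A : 'M[R[i]]_n) :
  A \is hermsymmx -> exists (U : 'M[R[i]]_n) (x : 'I_n -> R),
    U \is unitarymx /\ A = U *m diag_mx (\row_i (x i)%:C%C) *m U ^t*.
Proof.
move=> Ah; have /orthomx_spectralP AE := hermitian_normalmx Ah.
have Pu := spectral_unitarymx A; have xr := hermitian_spectral_diag_real Ah.
exists ((spectralmx A) ^t*), (fun i => complex.Re (spectral_diag A 0 i)).
split; first by rewrite trmxC_unitary.
rewrite trmxCK {1}AE (invmx_unitary Pu); congr (_ *m diag_mx _ *m _).
by apply/rowP => i; rewrite mxE RRe_real//; exact: (mxOverP xr).
Qed.

Lemma perm_mx_unitary (C : numClosedFieldType) n (s : {perm 'I_n}) :
  (perm_mx s : 'M[C]_n) \is unitarymx.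
Proof.
apply/unitarymxP; rewrite tr_perm_mx map_perm_mx -perm_mxM.
by rewrite mulgV perm_mx1.
Qed.

(** * The Frobenius norm in real coordinates *)

Lemma Re_mxtrace_mul (R : rcfType) d (A B : 'M[R[i]]_d) :
  complex.Re (\tr (A *m B)) = \sum_i \sum_j
  (complex.Re (A i j) * complex.Re (B j i)
   - complex.Im (A i j) * complex.Im (B j i)).
Proof.
rewrite /mxtrace raddf_sum; apply: eq_bigr => i _.
rewrite mxE raddf_sum; apply: eq_bigr => j _ /=.
by case: (A i j) (B j i) => [a b] [c e].
Qed.

Lemma frobenius2E (R : realType) d (X : 'M[R[i]]_d) : frobenius2 X =
  \sum_i \sum_j (complex.Re (X i j) ^+ 2 + complex.Im (X i j) ^+ 2).
Proof.
rewrite /frobenius2 /mxtrace raddf_sum exchange_big; apply: eq_bigr => i _.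
rewrite mxE raddf_sum; apply: eq_bigr => j _; rewrite !mxE /=.
by case: (X j i) => a b /=; rewrite mulNr opprK !expr2.
Qed.

Lemma frobenius2_ge0 (R : realType) d (X : 'M[R[i]]_d) : 0 <= frobenius2 X.
Proof.
rewrite frobenius2E; apply: sumr_ge0 => i _; apply: sumr_ge0 => j _.
by rewrite addr_ge0 ?sqr_ge0.
Qed.

Lemma frobenius2_eq0 (R : realType) d (X : 'M[R[i]]_d) :
  frobenius2 X = 0 -> X = 0.
Proof.
rewrite frobenius2E => /eqP; rewrite psumr_eq0 => [/allP h|i _]; last first.
  by apply: sumr_ge0 => j _; rewrite addr_ge0 ?sqr_ge0.
apply/matrixP => i j; have := h i (mem_index_enum _).
rewrite /= psumr_eq0 => [/allP/(_ j (mem_index_enum _))/=|k _]; last first.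
  by rewrite addr_ge0 ?sqr_ge0.
rewrite mxE paddr_eq0 ?sqr_ge0// !sqrf_eq0 => /andP[/eqP a /eqP b].
by apply/eqP; rewrite eq_complex a b /= eqxx.
Qed.

Lemma frobenius2_unitary (R : realType) d (U X : 'M[R[i]]_d) :
  U \is unitarymx -> frobenius2 (U *m X *m U ^t*) = frobenius2 X.
Proof.
move=> Uu; rewrite /frobenius2 !(trmx_mul, map_mxM) /= trmxCK.
rewrite -!mulmxA (mulmxA (U ^t*) U) (mulmxtU Uu) mul1mx mxtrace_mulC.
by rewrite -!mulmxA (mulmxtU Uu) mulmx1.
Qed.

(** * Expectation values on rank-one projections *)

(** The real part keeps this real-valued for every complex X; replacing X by -iX yields the
    imaginary part of Tr(PX). *)
Definition obs (R : realType) d (X : 'M[R[i]]_d) (P : rank1proj R d) : R :=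
  complex.Re (\tr (sval P *m X)).

Lemma rank1projP (R : realType) d (P : rank1proj R d) :
  [/\ sval P \is hermsymmx, sval P *m sval P = sval P & \rank (sval P) = 1%N].
Proof. by case: P => P /= /and3P[? /eqP ? /eqP ?]. Qed.

Lemma rank1proj_trace (R : realType) d (P : rank1proj R d) : \tr (sval P) = 1.
Proof. by have [_ PP rP] := rank1projP P; exact: rank1_idem_trace. Qed.

Lemma obsD (R : realType) d (X Y : 'M[R[i]]_d) P :
  obs (X + Y) P = obs X P + obs Y P.
Proof. by rewrite /obs mulmxDr mxtraceD raddfD. Qed.

Lemma obsZ (R : realType) d (c : R) (X : 'M[R[i]]_d) P :
  obs (c%:C%C *: X) P = c * obs X P.
Proof.
rewrite /obs -scalemxAr mxtraceZ; case: (\tr _) => a b /=.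
by rewrite mul0r subr0.
Qed.

Lemma obs1 (R : realType) d P : obs (1%:M : 'M[R[i]]_d) P = 1.
Proof. by rewrite /obs mulmx1 rank1proj_trace. Qed.

Lemma obs_unitary_conj (R : realType) d (U X : 'M[R[i]]_d)
    (hU : U \is unitarymx) P :
  obs X (unitary_conj hU P) = obs (U ^t* *m X *m U) P.
Proof. by rewrite /obs /= -!mulmxA mxtrace_mulC -!mulmxA. Qed.

Lemma mxtrace_mul_delta (S : comNzRingType) d (A : 'M[S]_d) i j :
  \tr (A *m delta_mx j i) = A i j.
Proof.
rewrite mxtrace_mulC /mxtrace (bigD1 j)//= mxE (bigD1 i)//= mxE !eqxx mul1r.
rewrite big1 => [|k /negbTE ki]; last by rewrite mxE ki andbF mul0r.
rewrite addr0 big1 ?addr0// => k /negbTE kj.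
by rewrite mxE big1// => l _; rewrite mxE kj mul0r.
Qed.

Lemma obs_delta (R : realType) d i j (P : rank1proj R d) :
  obs (delta_mx j i) P = complex.Re (sval P i j).
Proof. by rewrite /obs mxtrace_mul_delta. Qed.

Lemma obs_Ni_delta (R : realType) d i j (P : rank1proj R d) :
  obs (- 'i%C *: delta_mx j i) P = complex.Im (sval P i j).
Proof.
rewrite /obs -scalemxAr mxtraceZ mxtrace_mul_delta.
by case: (sval P i j) => a b; simpc.
Qed.

(** * Measurability, integrability and invariance of the integral *)

Lemma measurable_obs (R : realType) n (X : 'M[R[i]]_n.+1) :
  measurable_fun [set: rank1proj R n.+1] (obs X).
Proof.
have mRe i j :
    measurable_fun [set: rank1proj R n.+1] (fun P => complex.Re (sval P i j)).
  move=> _ B mB; rewrite setTI; apply: sub_sigma_algebra.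
  by exists i, j, B; split => //; left.
have mIm i j :
    measurable_fun [set: rank1proj R n.+1] (fun P => complex.Im (sval P i j)).
  move=> _ B mB; rewrite setTI; apply: sub_sigma_algebra.
  by exists i, j, B; split => //; right.
rewrite (_ : obs X = fun P => \sum_i \sum_j
  (complex.Re (sval P i j) * complex.Re (X j i)
   - complex.Im (sval P i j) * complex.Im (X j i))); last first.
  by apply/funext => P; exact: Re_mxtrace_mul.
apply: measurable_sum => i; apply: measurable_sum => j.
by apply: measurable_funB; apply: measurable_funM.
Qed.

Lemma obs_bounded (R : realType) d (X : 'M[R[i]]_d) :
  exists M : R, forall P, `|obs X P| <= M.
Proof.
exists (complex.Re (\sum_i \sum_j `|X j i|)) => P.
have [Ph PP rP] := rank1projP P; have tP := rank1proj_trace P.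
have : `|\tr (sval P *m X)| <= \sum_i \sum_j `|X j i|.
  apply: (le_trans (ler_norm_sum _ _ _)); apply: ler_sum => i _.
  rewrite mxE; apply: (le_trans (ler_norm_sum _ _ _)); apply: ler_sum => j _.
  by rewrite normrM ler_piMl//; exact: hermsymmx_idem_entry_le1.
move=> /(le_trans (normc_ge_Re _)); rewrite lecE => /andP[_].
exact.
Qed.

(** It suffices to test the generating cylinders. Each is a preimage under some [obs X], and
    conjugating the argument by U replaces X by [U ^t* *m X *m U]. *)
Lemma measurable_unitary_conj (R : realType) n (U : 'M[R[i]]_n.+1)
    (hU : U \is unitarymx) :
  measurable_fun [set: rank1proj R n.+1] (unitary_conj hU).
Proof.
apply: (@measurability _ _ _ _ _ _ (@entry_cylinders R n.+1)) => //.
have mB (X : 'M[R[i]]_n.+1) (B : set R) : measurable B ->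
    measurable (setT `&` unitary_conj hU @^-1` (obs X @^-1` B)).
  move=> mB; rewrite setTI -comp_preimage.
  rewrite (_ : obs X \o _ = obs (U ^t* *m X *m U)); last first.
    by apply/funext => P; rewrite /= obs_unitary_conj.
  by rewrite -[X in measurable X]setTI; exact: measurable_obs.
move=> _ [_ [i [j [B [mB' [->|->]]]]] <-].
- by under eq_set do rewrite -obs_delta; exact: mB.
- by under eq_set do rewrite -obs_Ni_delta; exact: mB.
Qed.

(** Invariance says that the pushforward of [mu] under the conjugation is [mu] again, so this is a
    change of variables. *)
Lemma Rintegral_unitary_conj (R : realType) n
    (mu : probability (rank1proj R n.+1) R) (mu_inv : unitarily_invariant mu)
    (U : 'M[R[i]]_n.+1) (hU : U \is unitarymx) (h : rank1proj R n.+1 -> R) :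
  mu.-integrable setT (EFin \o h) -> 
  mu.-integrable setT (EFin \o (h \o unitary_conj hU)) -> 
  Rintegral mu setT (h \o unitary_conj hU) = Rintegral mu setT h.
Proof.
move=> ih ihU; rewrite /Rintegral; congr fine.
pose mU := measurable_unitary_conj hU.
have mh : measurable_fun setT (EFin \o h) by have /integrableP[] := ih.
rewrite -[RHS](@eq_measure_integral _ _ _ _ _ (pushforward mu (unitary_conj hU))).
  by rewrite integral_pushforward.
by move=> A mA _; rewrite /= /pushforward mu_inv.
Qed.

Lemma bounded_integrable d (T : measurableType d) (R : realType)
    (mu : probability T R) (f : T -> R) : measurable_fun setT f ->
  (exists M, forall x, `|f x| <= M) -> mu.-integrable setT (EFin \o f).
Proof.
move=> mf [M hM]; apply: measurable_bounded_integrable => //.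
  by rewrite /= probability_setT ltry.
exists M; split; first exact: num_real.
by move=> z /ltW Mz x _ /=; exact: le_trans Mz.
Qed.

Lemma Rintegral_probability_cst d (T : measurableType d) (R : realType)
    (mu : probability T R) (c : R) : Rintegral mu setT (cst c) = c.
Proof. by rewrite Rintegral_cst//= probability_setT mulr1. Qed.

(** * Second moments and their unitary invariance *)

(** The real bilinear form that polarises the quadratic form q: q(A) is [moment mu A A]. *)
Definition moment (R : realType) n (mu : probability (rank1proj R n.+1) R)
    (X Y : 'M[R[i]]_n.+1) : R :=
  Rintegral mu setT (fun P => obs X P * obs Y P).

Lemma integrable_obs_mul (R : realType) n
    (mu : probability (rank1proj R n.+1) R) (X Y : 'M[R[i]]_n.+1) :
  mu.-integrable setT (EFin \o (fun P => obs X P * obs Y P)).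
Proof.
apply: bounded_integrable.
  by apply: measurable_funM; exact: measurable_obs.
have [M hM] := obs_bounded X; have [M' hM'] := obs_bounded Y.
by exists (M * M') => P; rewrite normrM ler_pM.
Qed.

Lemma momentC (R : realType) n (mu : probability (rank1proj R n.+1) R) X Y :
  moment mu X Y = moment mu Y X.
Proof. by apply: eq_Rintegral => P _; rewrite mulrC. Qed.

Lemma momentDl (R : realType) n (mu : probability (rank1proj R n.+1) R) X Y Z :
  moment mu (X + Y) Z = moment mu X Z + moment mu Y Z.
Proof.
rewrite /moment -RintegralD//; try exact: integrable_obs_mul.
by apply: eq_Rintegral => P _; rewrite obsD mulrDl.
Qed.

Lemma momentZl (R : realType) n (mu : probability (rank1proj R n.+1) R)
    (c : R) X Z : moment mu (c%:C%C *: X) Z = c * moment mu X Z.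
Proof.
rewrite /moment -RintegralZl//; try exact: integrable_obs_mul.
by apply: eq_Rintegral => P _; rewrite obsZ mulrA.
Qed.

Lemma moment0l (R : realType) n (mu : probability (rank1proj R n.+1) R) Z :
  moment mu 0 Z = 0.
Proof. by have := momentZl mu 0 0 Z; rewrite scaler0 mul0r. Qed.

Lemma moment_suml (R : realType) n (mu : probability (rank1proj R n.+1) R)
    (I : finType) (c : I -> R) (X : I -> 'M[R[i]]_n.+1) Z :
  moment mu (\sum_i (c i)%:C%C *: X i) Z = \sum_i c i * moment mu (X i) Z.
Proof.
rewrite (big_morph (moment mu ^~ Z) (fun X Y => momentDl mu X Y Z)
  (moment0l mu Z)).
by apply: eq_bigr => i _; rewrite momentZl.
Qed.

Lemma moment11 (R : realType) n (mu : probability (rank1proj R n.+1) R) :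
  moment mu 1%:M 1%:M = 1.
Proof.
rewrite -[RHS](Rintegral_probability_cst mu).
by apply: eq_Rintegral => P _; rewrite obs1 mul1r.
Qed.

Lemma moment_unitary (R : realType) n (mu : probability (rank1proj R n.+1) R)
    (U X Y : 'M[R[i]]_n.+1) : unitarily_invariant mu -> U \is unitarymx ->
  moment mu (U ^t* *m X *m U) (U ^t* *m Y *m U) = moment mu X Y.
Proof.
move=> mu_inv hU; pose h P := obs X P * obs Y P.
have E : (fun P => obs (U ^t* *m X *m U) P * obs (U ^t* *m Y *m U) P)
    = h \o unitary_conj hU.
  by apply/funext => P; rewrite /h /= !obs_unitary_conj.
rewrite /moment E (Rintegral_unitary_conj mu_inv)//.
  exact: integrable_obs_mul.
by rewrite -E; exact: integrable_obs_mul.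
Qed.

(** * Permutation symmetry and the reduction to two parameters *)

Lemma perm_mx_conj_delta (R : realType) n (s : {perm 'I_n}) a :
  (perm_mx s : 'M[R[i]]_n) ^t* *m delta_mx a a *m perm_mx s
  = delta_mx (s a) (s a).
Proof.
rewrite tr_perm_mx map_perm_mx -row_permE -[s in X in _ *m X]invgK -col_permE.
apply/matrixP => i j; rewrite !mxE.
by rewrite !(can2_eq (permKV s) (permK s)).
Qed.

Lemma two_transitive_perm (T : finType) (a b a' b' : T) : a != b -> a' != b' ->
  exists s : {perm T}, s a = a' /\ s b = b'.
Proof.
(* The first transposition sends a to a'; the second moves the image of b to b' and fixes a', which
   differs from both. *)
move=> ab a'b'; exists (tperm a a' * tperm (tperm a a' b) b')%g.
rewrite !permM tpermL; split; last by rewrite tpermL.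
rewrite tpermD 1?eq_sym//; apply: contra ab => /eqP.
by rewrite -[X in X = _](tpermL a a') => /perm_inj ->.
Qed.

Lemma moment_delta (R : realType) n (mu : probability (rank1proj R n.+1) R) :
  unitarily_invariant mu -> exists alpha beta : R, forall a b,
  moment mu (delta_mx a a) (delta_mx b b) = if a == b then alpha else beta.
Proof.
move=> mu_inv; pose m a b := moment mu (delta_mx a a) (delta_mx b b).
have mP (s : {perm 'I_n.+1}) a b : m (s a) (s b) = m a b.
  by rewrite /m -!perm_mx_conj_delta moment_unitary// perm_mx_unitary.
have mD a : m a a = m 0 0 by rewrite -(mP (tperm 0 a) 0 0) tpermL.
have [[a0 [b0 ab0]]|no] := pselect (exists a b : 'I_n.+1, a != b).
- exists (m 0 0), (m a0 b0) => a b; case: eqVneq => [->|ab]; first exact: mD.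
  by have [s [<- <-]] := two_transitive_perm ab0 ab; exact: mP.
(* In dimension one there are no two distinct indices, so beta is arbitrary and is set to 0. *)
- exists (m 0 0), 0 => a b; case: eqVneq => [->|ab]; first exact: mD.
  by case: no; exists a, b.
Qed.

(** After diagonalisation, q is the sum of x_a x_b times the moment of the diagonal units at a and
    b, where x lists the eigenvalues. The values on these units stay in the conclusion because the
    relation between alpha and beta is derived from them. *)
Lemma moment_hermsymmx_ex (R : realType) n
    (mu : probability (rank1proj R n.+1) R) : unitarily_invariant mu ->
  exists alpha beta : R,
  (forall a b, moment mu (delta_mx a a) (delta_mx b b) =
    if a == b then alpha else beta) /\
  forall A : 'M[R[i]]_n.+1, A \is hermsymmx ->
  moment mu A A = (alpha - beta) * frobenius2 A
                  + beta * complex.Re (\tr A) ^+ 2.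
Proof.
move=> mu_inv; have [al [be mE]] := moment_delta mu_inv; exists al, be.
split=> // A Ah; have [U [x [Uu ->]]] := hermsymmx_unitary_diag Ah.
(* U is rewritten as the adjoint of its adjoint, so that invariance applies with the unitary
   [U ^t*]. *)
rewrite frobenius2_unitary// -{1 3}(trmxCK U) moment_unitary ?trmxC_unitary//.
rewrite mxtrace_mulC mulmxA (mulmxtU Uu) mul1mx mxtrace_diag.
set D := diag_mx _.
have DE : D = \sum_a (x a)%:C%C *: delta_mx a a.
  by rewrite /D diag_mx_sum_delta; apply: eq_bigr => a _; rewrite mxE.
have -> : frobenius2 D = \sum_a x a ^+ 2.
  rewrite frobenius2E; apply: eq_bigr => a _; rewrite (bigD1 a)//= big1.
    by rewrite !mxE eqxx /= expr0n !addr0.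
  by move=> b /negbTE ba; rewrite !mxE eq_sym ba /= expr0n addr0.
have -> : complex.Re (\sum_i (\row_i0 (x i0)%:C%C) 0 i) = \sum_a x a.
  by rewrite raddf_sum; apply: eq_bigr => a _; rewrite mxE.
rewrite DE moment_suml mulr_sumr expr2 mulr_suml mulr_sumr -big_split/=.
apply: eq_bigr => a _; rewrite momentC moment_suml.
under [in LHS]eq_bigr => b _ do rewrite mE.
rewrite (bigD1 a)//= eqxx [in RHS](bigD1 a)//=.
under eq_bigr => b ba do rewrite (negbTE ba).
by rewrite -mulr_suml; ring.
Qed.

(** * Determination of the two parameters *)

Lemma mxtrace_delta (S : comNzRingType) d (i j : 'I_d) :
  \tr (delta_mx i j : 'M[S]_d) = (i == j)%:R.
Proof. by rewrite -[delta_mx i j]mul1mx mxtrace_mul_delta mxE eq_sym. Qed.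

Lemma delta_sum_sqr (S : comNzRingType) d (a b : 'I_d) : a != b ->
  let X : 'M[S]_d := delta_mx a b + delta_mx b a in
  X *m X = delta_mx a a + delta_mx b b.
Proof.
move=> ab X; have ba : (b == a) = false by rewrite eq_sym (negbTE ab).
rewrite /X mulmxDl !mulmxDr !mul_delta_mx_cond !eqxx (negbTE ab) ba.
by rewrite !mulr0n !mulr1n add0r addr0.
Qed.

Lemma delta_diff_sqr (S : comNzRingType) d (a b : 'I_d) (c : S) : a != b ->
  c * c = -1 ->
  let X : 'M[S]_d := c *: delta_mx a b - c *: delta_mx b a in
  X *m X = delta_mx a a + delta_mx b b.
Proof.
move=> ab cc X; have ba : (b == a) = false by rewrite eq_sym (negbTE ab).
rewrite /X mulmxBl !mulmxBr -!scalemxAl -!scalemxAr !scalerA cc.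
rewrite !mul_delta_mx_cond !eqxx (negbTE ab) ba !mulr0n !mulr1n.
by rewrite !scaler0 !scaleN1r subr0 sub0r !opprK.
Qed.

Lemma Re_natr (R : rcfType) m : complex.Re (m%:R : R[i]) = m%:R.
Proof. by elim: m => // m IH; rewrite -!natr1 raddfD /= IH. Qed.

Lemma Im_real0 (R : rcfType) (z : R[i]) : z \is Num.real -> complex.Im z = 0.
Proof. by move=> /RIm_real/complexI. Qed.

Lemma moment_hermsymmx (R : realType) n
    (mu : probability (rank1proj R n.+1) R) (A : 'M[R[i]]_n.+1) :
  unitarily_invariant mu -> A \is hermsymmx ->
  moment mu A A = (n.+1%:R * (n.+1%:R + 1))^-1
    * (frobenius2 A + complex.Re (\tr A) ^+ 2).
Proof.
move=> mu_inv Ah; have [al [be [mE mA]]] := moment_hermsymmx_ex mu_inv.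
(* The normalisation q(1) = 1, where |1|^2 = Tr 1 = d. *)
have I : (al - be) * n.+1%:R + be * n.+1%:R ^+ 2 = 1.
  rewrite -[RHS](moment11 mu) mA; last first.
    by apply/hermsymmxP; rewrite trmx1 map_mx1.
  rewrite /frobenius2 trmx1 map_mx1 mulmx1 mxtrace1.
  by rewrite Re_natr.
rewrite mA//; have d0 : (n.+1%:R : R) != 0 by rewrite pnatr_eq0.
have d1 : (n.+1%:R + 1 : R) != 0 by rewrite natr1 pnatr_eq0.
(* In dimension one A is a single real number, so |A|^2 = (Tr A)^2 and the normalisation alone
   decides. *)
case: (posnP n) => n0.
  have E : frobenius2 A = complex.Re (\tr A) ^+ 2.
    have := Im_real0 (mxtrace_hermsymmx_real Ah).
    rewrite frobenius2E /mxtrace; move: A Ah {mA I d0 d1}.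
    rewrite n0 => A Ah; rewrite !big_ord1 => ->.
    by rewrite expr0n addr0.
  rewrite E -mulrDl; move: (complex.Re _ ^+ 2) I => t.
  rewrite n0 expr1n !mulr1 subrK => ->.
  by field.
have [a [b ab]] : exists a b : 'I_n.+1, a != b.
  by exists 0, ord_max; rewrite -val_eqE /= eq_sym -lt0n.
(* These selfadjoint traceless matrices have expectation values 2 Re P_ab and 2 Im P_ab, so their
   squares add up to 4 |P_ab|^2. *)
pose X : 'M[R[i]]_n.+1 := delta_mx a b + delta_mx b a.
pose Y : 'M[R[i]]_n.+1 := 'i%C *: delta_mx a b - 'i%C *: delta_mx b a.
have ba : (b == a) = false by rewrite eq_sym (negbTE ab).
have Xh : X ^t* = X.
  rewrite /X linearD /= map_mxD.
  by rewrite !trmx_delta !map_delta_mx addrC.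
have Yh : Y ^t* = Y.
  apply/matrixP => i j; rewrite !mxE [(j == a) && _]andbC [(j == b) && _]andbC.
  case: ((i == b) && _); case: ((i == a) && _); rewrite ?mulr0 ?mulr1;
    by simpc; rewrite ?oppr0.
have XX : X *m X = delta_mx a a + delta_mx b b by exact: delta_sum_sqr.
have YY : Y *m Y = delta_mx a a + delta_mx b b.
  by apply: delta_diff_sqr => //; rewrite -expr2 sqr_i.
have trD : complex.Re (\tr (delta_mx a a + delta_mx b b : 'M[R[i]]_n.+1)) = 2.
  by rewrite mxtraceD !mxtrace_delta !eqxx.
have trX : \tr X = 0 by rewrite mxtraceD !mxtrace_delta ba (negbTE ab) addr0.
have trY : \tr Y = 0.
  by rewrite linearB /= !mxtraceZ !mxtrace_delta ba (negbTE ab) mulr0 subr0.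
have mX : moment mu X X = 2 * (al - be).
  rewrite mA; last exact/hermsymmxP.
  by rewrite /frobenius2 Xh XX trD trX expr0n mulr0 addr0 mulrC.
have mY : moment mu Y Y = 2 * (al - be).
  rewrite mA; last exact/hermsymmxP.
  by rewrite /frobenius2 Yh YY trD trY expr0n mulr0 addr0 mulrC.
have XYab : moment mu X X + moment mu Y Y = 4 * be.
  have := mE a b; rewrite (negbTE ab) => <-; rewrite -momentZl /moment.
  rewrite -RintegralD//; try exact: integrable_obs_mul.
  apply: eq_Rintegral => P _; rewrite obsZ.
  have [Ph _ rP] := rank1projP P.
  have eX : obs X P = 2 * complex.Re (sval P a b).
    rewrite obsD !obs_delta (hermsymmx_entry a b Ph).
    by case: (sval P a b) => x y /=; ring.
  have eY : obs Y P = 2 * complex.Im (sval P a b).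
    rewrite /Y -!scaleNr obsD obs_Ni_delta /obs -scalemxAr mxtraceZ.
    rewrite mxtrace_mul_delta (hermsymmx_entry a b Ph).
    by case: (sval P a b) => x y /=; ring.
  (* The vanishing minor reads P_aa P_bb = P_ab P_ba = |P_ab|^2, and the diagonal entries are
     real. *)
  have := rank1_exchange rP a a b b.
  rewrite eX eY !obs_delta (hermsymmx_entry a b Ph).
  have : complex.Im (sval P a a) = 0.
    by apply: Im_real0; apply/CrealP; rewrite -hermsymmx_entry.
  have : complex.Im (sval P b b) = 0.
    by apply: Im_real0; apply/CrealP; rewrite -hermsymmx_entry.
  case: (sval P a b) (sval P a a) (sval P b b) => [x y] [p p'] [q q'] /=.
  move=> -> -> /(congr1 (@complex.Re R)) /=.
  rewrite mul0r subr0 => e.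
  by rewrite -[4 * p * q]mulrA e; ring.
(* Two evaluations of q(X) + q(Y) are compared: 4 (alpha - beta) from the general formula and 4 beta
   from the rank-one identity. *)
have ab2 : al - be = be by move: XYab; rewrite mX mY; clear; lra.
have beE : be = (n.+1%:R * (n.+1%:R + 1))^-1.
  apply: (mulIf (mulf_neq0 d0 d1)); rewrite mulVf ?mulf_neq0// -[RHS]I ab2.
  by ring.
by rewrite ab2 -mulrDr beE.
Qed.

(** * From selfadjoint to arbitrary matrices *)

(** Writing H for this part of X and K for that of -iX, both are selfadjoint and X = H + iK. *)
Definition herm_part (R : realType) d (X : 'M[R[i]]_d) : 'M[R[i]]_d :=
  (2^-1)%:C%C *: (X + X ^t*).

Lemma herm_part_hermsymmx (R : realType) d (X : 'M[R[i]]_d) :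
  herm_part X \is hermsymmx.
Proof.
apply/hermsymmxP; apply/matrixP => i j; rewrite !mxE.
by case: (X i j) (X j i) => [a b] [c e]; congr Complex => /=; ring.
Qed.

Lemma mxtrace_adj (R : realType) d (X : 'M[R[i]]_d) :
  \tr (X ^t*) = (\tr X)^*.
Proof. by rewrite trace_map_mx mxtrace_tr. Qed.

(** As P is selfadjoint, replacing X by its adjoint conjugates Tr(PX) and leaves the real part
    unchanged. *)
Lemma obs_herm_part (R : realType) d (X : 'M[R[i]]_d) P :
  obs (herm_part X) P = obs X P.
Proof.
rewrite obsZ obsD (_ : obs (X ^t*) P = obs X P); first by field.
have [/hermsymmxP Ph _ _] := rank1projP P.
rewrite /obs -{1}Ph -map_mxM -trmx_mul mxtrace_adj mxtrace_mulC.
by case: (\tr _).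
Qed.

Lemma Re_mxtrace_herm_part (R : realType) d (X : 'M[R[i]]_d) :
  complex.Re (\tr (herm_part X)) = complex.Re (\tr X).
Proof.
rewrite mxtraceZ mxtraceD mxtrace_adj.
by case: (\tr X) => a b /=; field.
Qed.

(** Pythagoras: H and iK are orthogonal for the real inner product. *)
Lemma frobenius2_herm_part (R : realType) d (X : 'M[R[i]]_d) :
  frobenius2 (herm_part X) + frobenius2 (herm_part (- 'i%C *: X))
  = frobenius2 X.
Proof.
have S : frobenius2 X =
    \sum_i \sum_j (complex.Re (X j i) ^+ 2 + complex.Im (X j i) ^+ 2).
  by rewrite frobenius2E exchange_big.
apply: (mulfI (x := 2)); first by rewrite pnatr_eq0.
(* The entrywise identity mixes X_ij and X_ji, so the norm is doubled and one copy is summed in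
   transposed order. *)
rewrite [RHS]mulr_natl [RHS]mulr2n {2}S.
rewrite !frobenius2E -!big_split mulr_sumr; apply: eq_bigr => i _.
rewrite -!big_split mulr_sumr; apply: eq_bigr => j _; rewrite !mxE.
by case: (X i j) (X j i) => [a b] [c e] /=; field.
Qed.

Lemma normc_sqr (R : rcfType) (z : R[i]) :
  ComplexField.Normc.normc z ^+ 2 = complex.Re z ^+ 2 + complex.Im z ^+ 2.
Proof. by case: z => a b /=; rewrite sqr_sqrtr// addr_ge0 ?sqr_ge0. Qed.

Lemma normc_meas_map (R : realType) d (X : 'M[R[i]]_d) P :
  ComplexField.Normc.normc (meas_map X P) ^+ 2 = d%:R ^+ 2 *
  (obs X P * obs X P + obs (- 'i%C *: X) P * obs (- 'i%C *: X) P).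
Proof.
have -> : meas_map X P = (d%:R)%:C%C * \tr (sval P *m X).
  by rewrite /meas_map rmorph_nat.
rewrite normc_sqr /obs -scalemxAr mxtraceZ.
by case: (\tr _) => a b /=; ring.
Qed.

Lemma integral_obs_mul (R : realType) n
    (mu : probability (rank1proj R n.+1) R) (X Y : 'M[R[i]]_n.+1) :
  (\int[mu]_P (obs X P * obs Y P)%:E = (moment mu X Y)%:E)%E.
Proof.
rewrite /moment /Rintegral fineK//; apply: integrable_fin_num => //.
exact: integrable_obs_mul.
Qed.

(** The quadratic formula is applied to H and K. Their squared traces add up to |Tr X|^2, and d^2 /
    (d (d + 1)) = d / (d + 1). *)
Lemma L2norm2_meas_map (R : realType) n
    (mu : probability (rank1proj R n.+1) R) (X : 'M[R[i]]_n.+1) :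
  unitarily_invariant mu ->
  L2norm2 mu (meas_map X) = (n.+1%:R / (n.+1%:R + 1) *
    (frobenius2 X + ComplexField.Normc.normc (\tr X) ^+ 2))%:E.
Proof.
move=> mu_inv; have d0 : (n.+1%:R : R) != 0 by rewrite pnatr_eq0.
have d1 : (n.+1%:R + 1 : R) != 0 by rewrite natr1 pnatr_eq0.
pose Y := - 'i%C *: X.
have momentH Z : moment mu Z Z = (n.+1%:R * (n.+1%:R + 1))^-1 *
    (frobenius2 (herm_part Z) + complex.Re (\tr Z) ^+ 2).
  rewrite -Re_mxtrace_herm_part -(moment_hermsymmx mu_inv) ?herm_part_hermsymmx//.
  by apply: eq_Rintegral => P _; rewrite !obs_herm_part.
have iXY : mu.-integrable setT (fun P => (obs X P * obs X P)%:E
    + (obs Y P * obs Y P)%:E)%E.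
  by apply: integrableD => //; exact: integrable_obs_mul.
rewrite /L2norm2 (eq_integral (fun P => (n.+1%:R ^+ 2)%:E *
  ((obs X P * obs X P)%:E + (obs Y P * obs Y P)%:E))%E); last first.
  by move=> P _; rewrite normc_meas_map.
rewrite integralZl// integralD//; try exact: integrable_obs_mul.
rewrite !integral_obs_mul !momentH -EFinD -EFinM; congr EFin.
rewrite -(frobenius2_herm_part X) normc_sqr.
have -> : complex.Re (\tr Y) = complex.Im (\tr X).
  by rewrite mxtraceZ; case: (\tr X) => a b /=; ring.
move: (frobenius2 _) (frobenius2 _) (complex.Re _) (complex.Im _) => f g x y.
move: (n.+1%:R : R) d0 d1 => D d0 d1; clear -d0 d1.
by field; apply/andP.
Qed.

(** * Real coordinates and continuity on selfadjoint matrices *)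

(* An R-linear bijection from all real matrices onto the selfadjoint ones, so
   that compactness can be taken from 'rV[R]_(d * d). *)
Definition hermmx_of (R : realType) d (V : 'M[R]_d) : 'M[R[i]]_d :=
  \matrix_(i, j) Complex (V i j + V j i) (V i j - V j i).

(** The inverse on selfadjoint X, obtained by solving V_ij + V_ji = Re X_ij and V_ij - V_ji = Im
    X_ij. *)
Definition real_of_hermmx (R : realType) d (X : 'M[R[i]]_d) : 'M[R]_d :=
  \matrix_(i, j) ((complex.Re (X i j) + complex.Im (X i j)) / 2).

Lemma hermmx_of_hermsymmx (R : realType) d (V : 'M[R]_d) :
  hermmx_of V \is hermsymmx.
Proof.
apply/hermsymmxP; apply/matrixP => i j; rewrite !mxE.
by congr Complex => /=; ring.
Qed.

Lemma real_of_hermmxK (R : realType) d (X : 'M[R[i]]_d) : X \is hermsymmx ->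
  hermmx_of (real_of_hermmx X) = X.
Proof.
move=> Xh; apply/matrixP => i j; rewrite !mxE (hermsymmx_entry i j Xh).
by case: (X i j) => a b; congr Complex => /=; field.
Qed.

Lemma frobenius2_hermmx_of (R : realType) d (V : 'M[R]_d) :
  frobenius2 (hermmx_of V) = 4 * \sum_i \sum_j V i j ^+ 2.
Proof.
have S : \sum_i \sum_j V i j ^+ 2 = \sum_i \sum_j V j i ^+ 2.
  exact: exchange_big.
have -> : 4 * \sum_i \sum_j V i j ^+ 2
    = 2 * (\sum_i \sum_j V i j ^+ 2 + \sum_i \sum_j V j i ^+ 2).
  by rewrite -S; ring.
rewrite frobenius2E -big_split mulr_sumr; apply: eq_bigr => i _.
rewrite -big_split mulr_sumr; apply: eq_bigr => j _; rewrite !mxE /=.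
by ring.
Qed.

(** Serves to bound the sublevel sets of the Frobenius distance in the real coordinates. *)
Lemma entry_le_frobenius2_hermmx_of (R : realType) d (V : 'M[R]_d) i j :
  V i j ^+ 2 <= frobenius2 (hermmx_of V).
Proof.
rewrite frobenius2_hermmx_of (bigD1 i)//= (bigD1 j)//=.
set s := \sum_(_ | _) _; set t := \sum_(_ | _) _.
have s0 : 0 <= s by apply: sumr_ge0 => k _; rewrite sqr_ge0.
have t0 : 0 <= t.
  by apply: sumr_ge0 => k _; apply: sumr_ge0 => l _; rewrite sqr_ge0.
rewrite -addrA (le_trans (y := 4 * V i j ^+ 2))//.
  by rewrite ler_peMl ?sqr_ge0// ler1n.
by rewrite ler_wpM2l// lerDl addr_ge0.
Qed.

Lemma continuous_sum (T : topologicalType) (R : realType) (I : Type)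
    (r : seq I) (F : I -> T -> R) : (forall i, continuous (F i)) ->
  continuous (fun x => \sum_(i <- r) F i x).
Proof.
move=> cF; elim: r => [|i r IH] x.
  rewrite (_ : (fun _ => _) = cst 0); first exact: cvg_cst.
  by apply/funext => y; rewrite big_nil.
rewrite (_ : (fun _ => _) = F i \+ (fun y => \sum_(k <- r) F k y)).
  by apply: continuousD; [exact: cF|exact: IH].
by apply/funext => y; rewrite big_cons.
Qed.

Lemma continuous_vec_mx (R : realType) d i j :
  continuous (fun v : 'rV[R]_(d * d) => (vec_mx v : 'M[R]_d) i j).
Proof.
rewrite (_ : (fun _ => _) = fun v : 'rV[R]_(d * d) => v 0 (mxvec_index i j)).
  exact: coord_continuous.
by apply/funext => v; rewrite mxE.
Qed.

Lemma continuous_Re_mxtrace_hermmx_of (R : realType) d (X L : 'M[R[i]]_d) :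
  continuous (fun v : 'rV[R]_(d * d) =>
    complex.Re (\tr (X *m (L + hermmx_of (vec_mx v))))).
Proof.
rewrite (_ : (fun _ => _) = fun v : 'rV[R]_(d * d) => \sum_i \sum_j
  (complex.Re (X i j) * (complex.Re (L j i)
     + ((vec_mx v : 'M[R]_d) j i + (vec_mx v : 'M[R]_d) i j))
   - complex.Im (X i j) * (complex.Im (L j i)
     + ((vec_mx v : 'M[R]_d) j i - (vec_mx v : 'M[R]_d) i j)))); last first.
  apply/funext => v; rewrite Re_mxtrace_mul; apply: eq_bigr => i _.
  apply: eq_bigr => j _; rewrite [(L + _) j i]mxE [hermmx_of _ j i]mxE.
  by case: (L j i).
have C (T : topologicalType) (f g : T -> R) (p q r s : R) :
    continuous f -> continuous g ->
    continuous (fun x => p * (q + (f x + g x)) - r * (s + (f x - g x))).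
  move=> cf cg x; apply: cvgB; (apply: cvgM; first exact: cvg_cst).
    by apply: cvgD; [exact: cvg_cst|apply: cvgD; [exact: cf|exact: cg]].
  by apply: cvgD; [exact: cvg_cst|apply: cvgB; [exact: cf|exact: cg]].
apply: continuous_sum => i; apply: continuous_sum => j.
by apply: C; exact: continuous_vec_mx.
Qed.

Lemma continuous_frobenius2_hermmx_of (R : realType) d :
  continuous (fun v : 'rV[R]_(d * d) => frobenius2 (hermmx_of (vec_mx v))).
Proof.
rewrite (_ : (fun _ => _) = fun v : 'rV[R]_(d * d) =>
  4 * \sum_i \sum_j ((vec_mx v : 'M[R]_d) i j ^+ 2)); last first.
  by apply/funext => v; exact: frobenius2_hermmx_of.
have C (T : topologicalType) (f : T -> R) : continuous f ->
    continuous (fun x => 4 * f x).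
  by move=> cf x; apply: cvgM; [exact: cvg_cst|exact: cf].
have C2 (T : topologicalType) (f : T -> R) : continuous f ->
    continuous (fun x => f x ^+ 2).
  by move=> cf x; apply: cvgM; exact: cf.
apply: C; apply: continuous_sum => i; apply: continuous_sum => j.
by apply: C2; exact: continuous_vec_mx.
Qed.

(** * Frobenius projection onto the density matrices *)

(** Recasts the conditions as real constraints on functions Re Tr(AX), which are linear in X;
    closedness and convexity can be read off. The imaginary parts vanish by selfadjointness. *)
Lemma density_matrixP (R : realType) d (X : 'M[R[i]]_d) : X \is hermsymmx ->
  density_matrix X <->
  (forall w : 'cV_d, 0 <= complex.Re (\tr ((w *m w ^t*) *m X)))
  /\ complex.Re (\tr (1%:M *m X)) = 1.
Proof.
move=> Xh.
have vE (w : 'cV[R[i]]_d) :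
    (w ^t* *m X *m w) 0 0 = \tr ((w *m w ^t*) *m X).
  by rewrite -trace_mx11 mxtrace_mulC mulmxA.
have vI (w : 'cV[R[i]]_d) : complex.Im ((w ^t* *m X *m w) 0 0) = 0.
  apply: Im_real0; apply/CrealP; rewrite -hermsymmx_entry//.
  apply/hermsymmxP; rewrite !(trmx_mul, map_mxM) /= trmxCK.
  by rewrite (hermsymmxP _ Xh) mulmxA.
have tI : complex.Im (\tr X) = 0 by exact/Im_real0/mxtrace_hermsymmx_real.
rewrite mul1mx; split=> [[_ Xp tX]|[Xp tX]].
  split=> [w|]; last by rewrite tX.
  by have := Xp w; rewrite lecE vE => /andP[].
split=> // [w|]; first by rewrite lecE vI eqxx vE Xp.
by apply/eqP; rewrite eq_complex tX tI /= !eqxx.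
Qed.

Lemma density_matrix_delta (R : realType) n :
  density_matrix (delta_mx 0 0 : 'M[R[i]]_n.+1).
Proof.
apply/density_matrixP.
  by apply/hermsymmxP; rewrite trmx_delta map_delta_mx.
rewrite mul1mx mxtrace_delta; split=> // w.
rewrite mxtrace_mul_delta !mxE big_ord1 !mxE.
by case: (w 0 0) => a b /=; rewrite mulrN opprK -!expr2 addr_ge0 ?sqr_ge0.
Qed.

Lemma density_matrix_midpoint (R : realType) d (X Y : 'M[R[i]]_d) :
  density_matrix X -> density_matrix Y ->
  density_matrix ((2^-1)%:C%C *: (X + Y)).
Proof.
move=> dX dY; have [Xh _ _] := dX; have [Yh _ _] := dY.
have [Xp tX] := (density_matrixP Xh).1 dX.
have [Yp tY] := (density_matrixP Yh).1 dY.
have E (A : 'M[R[i]]_d) : complex.Re (\tr (A *m ((2^-1)%:C%C *: (X + Y))))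
    = 2^-1 * (complex.Re (\tr (A *m X)) + complex.Re (\tr (A *m Y))).
  rewrite -scalemxAr mxtraceZ mulmxDr mxtraceD.
  by case: (\tr _) (\tr _) => [a b] [c e] /=; ring.
apply/density_matrixP.
  apply/hermsymmxP; rewrite linearZ /= map_mxZ linearD /= map_mxD.
  rewrite (hermsymmxP _ Xh) (hermsymmxP _ Yh); congr (_ *: _).
  exact: conjc_real.
split=> [w|]; rewrite E; last by rewrite tX tY; field.
by rewrite mulr_ge0 ?invr_ge0 ?addr_ge0.
Qed.

(** The parallelogram law for X - L and Y - L, whose sum is twice the midpoint minus 2 L. *)
Lemma frobenius2_midpoint (R : realType) d (X Y L : 'M[R[i]]_d) :
  4 * frobenius2 ((2^-1)%:C%C *: (X + Y) - L) + frobenius2 (X - Y)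
  = 2 * (frobenius2 (X - L) + frobenius2 (Y - L)).
Proof.
rewrite !frobenius2E mulr_sumr -!big_split mulr_sumr; apply: eq_bigr => i _.
rewrite mulr_sumr -!big_split mulr_sumr; apply: eq_bigr => j _ /=; rewrite !mxE.
by case: (X i j) (Y i j) (L i j) => [a b] [c e] [f g] /=; field.
Qed.

Lemma frobenius2N (R : realType) d (X : 'M[R[i]]_d) :
  frobenius2 (- X) = frobenius2 X.
Proof.
rewrite !frobenius2E; apply: eq_bigr => i _; apply: eq_bigr => j _.
by rewrite mxE; case: (X i j) => a b /=; rewrite !sqrrN.
Qed.

(** The midpoint of two minimisers is a state no closer to L than either, so the parallelogram law
    leaves |X - Y|^2 <= 0. *)
Lemma projection_density_unique (R : realType) d (L X Y : 'M[R[i]]_d) :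
  is_argmin (@density_matrix R d) (fun tau => frobenius2 (tau - L)) X ->
  is_argmin (@density_matrix R d) (fun tau => frobenius2 (tau - L)) Y ->
  X = Y.
Proof.
move=> [dX mX] [dY mY]; apply/eqP; rewrite -subr_eq0; apply/eqP.
apply: frobenius2_eq0; apply/eqP; rewrite eq_le frobenius2_ge0 andbT.
have := frobenius2_midpoint X Y L; have := mX _ (density_matrix_midpoint dX dY).
have := mY _ (density_matrix_midpoint dX dY).
move: (frobenius2 _) (frobenius2 _) (frobenius2 _) (frobenius2 _) => a b c e.
by clear; lra.
Qed.

Lemma hermsymmx_density (R : realType) d (X : 'M[R[i]]_d) :
  density_matrix X -> X \is hermsymmx.
Proof. by case. Qed.

Lemma projection_density_exists (R : realType) n (L : 'M[R[i]]_n.+1) :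
  L \is hermsymmx -> exists X,
  is_argmin (@density_matrix R n.+1) (fun tau => frobenius2 (tau - L)) X.
Proof.
move=> Lh; pose h (v : 'rV[R]_(n.+1 * n.+1)) := hermmx_of (vec_mx v).
have hS X : X \is hermsymmx -> exists v, h v = X - L.
  move=> Xh; exists (mxvec (real_of_hermmx (X - L))).
  rewrite /h mxvecK; apply: real_of_hermmxK; apply/hermsymmxP.
  by rewrite linearB /= map_mxB (hermsymmxP _ Xh) (hermsymmxP _ Lh).
have hH v : L + h v \is hermsymmx.
  apply/hermsymmxP; rewrite linearD /= map_mxD (hermsymmxP _ Lh).
  by rewrite (hermsymmxP _ (hermmx_of_hermsymmx _)).
have [v0 hv0] := hS _ (hermsymmx_density (density_matrix_delta R n)).
pose f v := frobenius2 (h v); have cf : continuous f.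
  exact: continuous_frobenius2_hermmx_of.
(* States are written as L + [h v], so the objective is |[h v]|^2; cutting at the value of one fixed
   state makes the domain bounded. *)
pose A := [set v | density_matrix (L + h v)] `&` [set v | f v <= f v0].
have Acl : closed A.
  apply: closedI; last first.
    exact: (continuous_closedP f).1 cf _ (@closed_le R (f v0)).
  (* The states form an intersection of closed half-spaces, one for each vector w, with a closed
     hyperplane. *)
  rewrite (_ : [set v | _] = (\bigcap_(w in [set: 'cV_n.+1])
     [set v | 0 <= complex.Re (\tr ((w *m w ^t*) *m (L + h v)))]) `&`
     [set v | complex.Re (\tr (1%:M *m (L + h v))) = 1]); last first.
    apply/seteqP; split=> v /=.
      by move=> /(density_matrixP (hH v))[p t]; split=> // w _; exact: p.
    move=> [p t]; apply/(density_matrixP (hH v)); split=> // w.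
    by have := p w I.
  apply: closedI; last first.
    have c := @continuous_Re_mxtrace_hermmx_of R n.+1 1%:M L.
    exact: (continuous_closedP _).1 c _ (@closed_eq R 1).
  apply: closed_bigI => w _.
  have c := @continuous_Re_mxtrace_hermmx_of R n.+1 (w *m w ^t*) L.
  exact: (continuous_closedP _).1 c _ (@closed_ge R 0).
have Acpt : compact A.
  apply: bounded_closed_compact => //.
  exists (Num.sqrt (f v0)); split; first exact: num_real.
  (* The norm of a row vector is its largest absolute entry, and each entry is at most the square
     root of [f v0]. *)
  move=> M /ltW sM v [_ /= fv]; rewrite [leLHS]/Num.norm /= mx_normrE.
  apply/bigmax_leP; split; first exact: le_trans (sqrtr_ge0 _) sM.
  move=> [i j] _ /=; apply: le_trans sM.
  rewrite -sqrtr_sqr ler_wsqrtr//; apply: le_trans fv.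
  case/mxvec_indexP: j => k l.
  have := entry_le_frobenius2_hermmx_of (vec_mx v) k l.
  by rewrite mxE ord1.
have A0 : A !=set0.
  exists v0; split=> //=; rewrite hv0 addrC subrK; exact: density_matrix_delta.
have [v vA mv] := EVT_min_rV A0 Acpt (continuous_subspaceT cf).
have [dv fv] := set_mem vA.
exists (L + h v); split=> [|Y dY]; first exact: dv.
have [u hu] := hS _ (hermsymmx_density dY).
rewrite addrC addKr -hu -/(f v) -/(f u).
(* A state outside the sublevel set is worse than [v0], hence worse than the minimiser [v]. *)
have [fu|/ltW fu] := leP (f u) (f v0); last exact: le_trans fu.
by apply: mv; apply/mem_set; split=> //=; rewrite hu addrC subrK.
Qed.

(** * The least squares loss *)

Lemma frobenius2B (R : realType) d (X L : 'M[R[i]]_d) : L \is hermsymmx ->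
  frobenius2 (X - L) =
  frobenius2 X - 2 * complex.Re (\tr (L *m X)) + frobenius2 L.
Proof.
move=> Lh; have -> : complex.Re (\tr (L *m X)) = \sum_i \sum_j
    (complex.Re (L i j) * complex.Re (X i j)
     + complex.Im (L i j) * complex.Im (X i j)).
  rewrite Re_mxtrace_mul exchange_big; apply: eq_bigr => i _.
  apply: eq_bigr => j _; rewrite (hermsymmx_entry i j Lh).
  by case: (L i j) => a b /=; rewrite mulNr opprK.
rewrite !frobenius2E mulr_sumr -sumrB -big_split; apply: eq_bigr => i _.
rewrite mulr_sumr -sumrB -big_split; apply: eq_bigr => j _; rewrite !mxE.
by case: (X i j) (L i j) => [a b] [c e] /=; ring.
Qed.

(** The N subtracted multiples of the identity add up to exactly one identity matrix. *)
Lemma rho_LSE (R : realType) d N (P : 'I_N -> rank1proj R d) : (0 < N)%N ->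
  rho_LS P =
  ((d%:R + 1) / N%:R)%:C%C *: \sum_(i < N) sval (P i) - 1%:M.
Proof.
move=> N0; have N0' : (N%:R : R[i]) != 0 by rewrite pnatr_eq0 -lt0n.
have d0 : (d%:R + 1 : R[i]) != 0 by rewrite natr1 pnatr_eq0.
rewrite /rho_LS sumrB sumr_const card_ord scalerBr; congr (_ *: _ - _).
  by rewrite rmorphM rmorphD fmorphV !rmorph_nat rmorph1.
rewrite -(raddfMn (@scalar_mx _ d)) scale_scalar_mx; congr (_%:M).
by rewrite -[X in _ * X]mulr_natr mulrA mulrAC divfK// mulfV.
Qed.

Lemma rho_LS_hermsymmx (R : realType) d N (P : 'I_N -> rank1proj R d) :
  (0 < N)%N -> rho_LS P \is hermsymmx.
Proof.
move=> N0; rewrite rho_LSE//; apply/hermsymmxP/matrixP => i j.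
rewrite !mxE rmorphB rmorphM !summxE rmorph_sum rmorph_nat eq_sym.
congr (_ * _ - _); first exact: conjc_real.
apply: eq_bigr => k _; have [Ph _ _] := rank1projP (P k).
by rewrite (hermsymmx_entry j i Ph).
Qed.

Lemma mxtrace_rho_LS (R : realType) d N (P : 'I_N -> rank1proj R d) :
  (0 < N)%N -> \tr (rho_LS P) = 1.
Proof.
move=> N0; have N0' : (N%:R : R[i]) != 0 by rewrite pnatr_eq0 -lt0n.
have tS : \tr (\sum_(i < N) sval (P i)) = N%:R.
  rewrite raddf_sum (eq_bigr (fun=> 1)) ?sumr_const ?card_ord// => i _.
  exact: rank1proj_trace.
rewrite rho_LSE// raddfB /= mxtraceZ mxtrace1 tS.
rewrite rmorphM rmorphD fmorphV !rmorph_nat rmorph1.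
by rewrite divfK// addrAC subrr add0r.
Qed.

(** [rho_LS P] plus the identity is (d + 1) / N times the sum of the outcomes; pairing this with X
    gives both traces. *)
Lemma mean_meas_map (R : realType) d N (P : 'I_N -> rank1proj R d)
    (X : 'M[R[i]]_d) : (0 < N)%N ->
  N%:R^-1 * \sum_(i < N) complex.Re (meas_map X (P i)) = d%:R / (d%:R + 1) *
  (complex.Re (\tr (rho_LS P *m X)) + complex.Re (\tr X)).
Proof.
move=> N0; have N0' : (N%:R : R) != 0 by rewrite pnatr_eq0 -lt0n.
have d0 : (d%:R + 1 : R) != 0 by rewrite natr1 pnatr_eq0.
have trS : complex.Re (\tr ((\sum_(i < N) sval (P i)) *m X)) =
    \sum_(i < N) complex.Re (\tr (sval (P i) *m X)).
  by rewrite mulmx_suml (raddf_sum (@mxtrace _ d)) raddf_sum.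
have -> : complex.Re (\tr (rho_LS P *m X)) + complex.Re (\tr X) =
    (d%:R + 1) / N%:R * \sum_(i < N) complex.Re (\tr (sval (P i) *m X)).
  rewrite -trS -raddfD -mxtraceD rho_LSE// mulmxBl mul1mx subrK -scalemxAl.
  by rewrite mxtraceZ; case: (\tr _) => a b /=; rewrite mul0r subr0.
have -> : \sum_(i < N) complex.Re (meas_map X (P i)) =
    d%:R * \sum_(i < N) complex.Re (\tr (sval (P i) *m X)).
  rewrite mulr_sumr; apply: eq_bigr => i _.
  rewrite /meas_map -(rmorph_nat (real_complex R)); case: (\tr _) => a b /=.
  by rewrite mul0r subr0.
move: (\sum_(i < N) _) => s; move: (d%:R) (N%:R) N0' d0 => D M; clear => ? ?.
by field; apply/andP.
Qed.

(** With L the estimator and t = Tr X, the bracket |X|^2 + t^2 - 2 (Re Tr(LX) + t) is completed to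
    squares in X and in t. *)
Lemma ls_lossE (R : realType) n (mu : probability (rank1proj R n.+1) R)
    N (P : 'I_N -> rank1proj R n.+1) (X : 'M[R[i]]_n.+1) :
  unitarily_invariant mu -> (0 < N)%N -> X \is hermsymmx ->
  ls_loss mu P X = (n.+1%:R / (n.+1%:R + 1) *
    (frobenius2 (X - rho_LS P) + (complex.Re (\tr X) - 1) ^+ 2
     - (frobenius2 (rho_LS P) + 1)))%:E.
Proof.
move=> mu_inv N0 Xh; rewrite /ls_loss L2norm2_meas_map// mean_meas_map//.
rewrite (frobenius2B _ (rho_LS_hermsymmx P N0)) normc_sqr.
rewrite (Im_real0 (mxtrace_hermsymmx_real Xh)) -EFinB; congr EFin.
move: (frobenius2 _) (frobenius2 _) (complex.Re _) (complex.Re _) (_ / _).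
by move=> f g x y c; ring.
Qed.

(** * Comparison of the minimisers *)

Lemma frobenius2_0 (R : realType) d : frobenius2 (0 : 'M[R[i]]_d) = 0.
Proof. by rewrite /frobenius2 mulmx0 mxtrace0. Qed.

(** Only the order that a loss induces on the feasible set matters, which allows comparing
    extended-real with real losses. *)
Lemma is_argmin_iff (disp disp' : Order.disp_t) (V : porderType disp)
    (V' : porderType disp') (T : Type) (S : set T) (f : T -> V) (g : T -> V')
    x : (forall y z, S y -> S z -> (f y <= f z)%O = (g y <= g z)%O) ->
  is_argmin S f x <-> is_argmin S g x.
Proof.
by move=> fg; split=> -[Sx m]; split=> // y Sy; have := m y Sy; rewrite fg.
Qed.

Lemma meas_mapB (R : realType) d (X Y : 'M[R[i]]_d) P :
  meas_map X P - meas_map Y P = meas_map (X - Y) P.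
Proof. by rewrite /meas_map mulmxBr raddfB /= mulrBr. Qed.

Theorem mainTheorem4 (R : realType) (n : nat)
    (mu : probability (rank1proj R n.+1) R)
    (mu_inv : unitarily_invariant mu) :
  let d : nat := n.+1 in
  [/\ (forall rho tau : 'M[R[i]]_d,
         density_matrix rho -> density_matrix tau ->
         L2norm2 mu (fun P => meas_map rho P - meas_map tau P)
         = (d%:R / (d%:R + 1) * frobenius2 (rho - tau))%:E),
      (forall X : 'M[R[i]]_d, \tr X = 0 ->
         L2norm2 mu (meas_map X) = (d%:R / (d%:R + 1) * frobenius2 X)%:E)
    & forall (N : nat) (P : 'I_N -> rank1proj R d), (0 < N)%N ->
        [/\ (forall tau : 'M[R[i]]_d, is_LS mu P tau <-> tau = rho_LS P),
            (exists! rho : 'M[R[i]]_d, is_posLS mu P rho),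
            (forall rho : 'M[R[i]]_d, is_posLS mu P rho <->
               is_argmin (@density_matrix R d)
                 (fun tau => meas_dist mu (rho_LS P) tau) rho)
          & (forall rho : 'M[R[i]]_d, is_posLS mu P rho <-> is_PLS P rho)]].
Proof.
move=> d; pose c : R := d%:R / (d%:R + 1).
have c0 : 0 < c by rewrite divr_gt0 ?ltr0Sn// natr1 ltr0Sn.
have iso (X : 'M[R[i]]_d) : \tr X = 0 ->
    L2norm2 mu (meas_map X) = (c * frobenius2 X)%:E.
  by move=> tX; rewrite L2norm2_meas_map// tX normc_sqr expr0n !addr0.
have isoB (X Y : 'M[R[i]]_d) : \tr X = 1 -> \tr Y = 1 ->
    L2norm2 mu (fun P => meas_map X P - meas_map Y P)
    = (c * frobenius2 (X - Y))%:E.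
  move=> tX tY; rewrite -iso; last by rewrite raddfB /= tX tY subrr.
  by congr L2norm2; apply/funext => P; rewrite meas_mapB.
split=> [rho tau [_ _ ?] [_ _ ?]|//|N P N0]; first exact: isoB.
pose L := rho_LS P; have Lh : L \is hermsymmx := rho_LS_hermsymmx P N0.
have tL : \tr L = 1 := mxtrace_rho_LS P N0.
have lossE (X : 'M[R[i]]_d) : X \is hermsymmx ->
    ls_loss mu P X = (c * (frobenius2 (X - L)
      + (complex.Re (\tr X) - 1) ^+ 2 - (frobenius2 L + 1)))%:E.
  exact: ls_lossE.
have Re1 : (complex.Re (1 : R[i]) - 1 : R) ^+ 2 = 0 by rewrite subrr expr0n.
have fLL : frobenius2 (L - L) = 0 by rewrite subrr; exact: frobenius2_0.
have posLSE rho : is_posLS mu P rho <->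
    is_argmin (@density_matrix R d) (fun tau => frobenius2 (tau - L)) rho.
  apply: is_argmin_iff => X Y [Xh _ tX] [Yh _ tY].
  (* All states have trace 1, so the trace term is a common summand and cancels along with the
     constant. *)
  rewrite (lossE _ Xh) (lossE _ Yh) lee_fin tX tY (ler_pM2l c0).
  by rewrite lerD2r lerD2r.
have FC (X : 'M[R[i]]_d) : frobenius2 (L - X) = frobenius2 (X - L).
  by rewrite -frobenius2N opprB.
split.
- move=> tau; split=> [[/= th m]|->].
  (* At L both squares vanish, since Tr L = 1; a minimiser must therefore satisfy |tau - L|^2 <=
     0. *)
  + have := m _ Lh; rewrite (lossE _ th) (lossE _ Lh) lee_fin.
    rewrite (ler_pM2l c0) lerD2r tL Re1 fLL addr0 => le0.
    apply/eqP; rewrite -subr_eq0; apply/eqP/frobenius2_eq0/eqP.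
    by rewrite eq_le frobenius2_ge0 andbT (le_trans _ le0)// lerDl sqr_ge0.
  + split=> [//|X Xh]; rewrite (lossE _ Lh) (lossE _ Xh) lee_fin.
    rewrite (ler_pM2l c0) lerD2r tL Re1 fLL.
    by rewrite addr0 addr_ge0 ?frobenius2_ge0 ?sqr_ge0.
- have [X mX] := projection_density_exists Lh.
  exists X; split; first exact/posLSE.
  by move=> Y /posLSE; exact: projection_density_unique.
- move=> rho; apply: (iff_trans (posLSE rho)).
  apply: is_argmin_iff => X Y [_ _ tX] [_ _ tY].
  (* L need not be a state, but it has trace 1, so the isometry applies to its difference from any
     state. *)
  rewrite /meas_dist !isoB// lee_sqrt; last first.
    by rewrite lee_fin mulr_ge0 ?frobenius2_ge0// ltW.
  by rewrite lee_fin (ler_pM2l c0) (FC X) (FC Y).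
- move=> rho; apply: (iff_trans (posLSE rho)).
  apply: is_argmin_iff => X Y _ _.
  by rewrite /frobenius (FC X) (FC Y) ler_sqrt ?frobenius2_ge0.
Qed.
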